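(* Let $X_Q=V(r^2-qs)\subset\mathbb{C}^4$ and for $d\in\mathbb{N}$ let $g_d:X_Q\to X_Q$ be the Chebyshev-induced morphism on $\mathbb{C}^3/D_4\simeq X_Q$. Let $L_1=V(q,r,s)=\{(t,0,0,0):t\in\mathbb{C}\}$, let $G_1(t)=(t^2,\ (2t-2)^2,\ (2t-2)t^2,\ t^4)$, and let $C_1=V(r^2-qs,\ -16p-12r+qr+20s-4ps+qs,\ 4pr+4s-4ps+qs,\ 16-8q+q^2+32r-16s,\ 4p+pq+4r-4s,\ p^2-s)$. (1) If $d$ is odd then $g_d(L_1)=L_1$; in particular $g_d(t,0,0,0)=(T_d(\sqrt t)^2,0,0,0)$. (2) $g_2(L_1)=C_1$. (3) $g_d(C_1)=C_1$ for every $d\ge1$; in particular $g_d(G_1(w+2))=G_1(T_d(w)+2)$ for all $w\in\mathbb{C}$.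
   Context: $\mathbb{N}=\{1,2,\dots\}$. $T_d(z)$ is the one-variable Chebyshev polynomial with $T_d(s+s^{-1})=s^d+s^{-d}$; for $d$ odd, $T_d(\sqrt t)^2$ is a polynomial in $t$. Definition of $g_d$: the Chebyshev endomorphism $P_{A_3}^d:\mathbb{C}^3\to\mathbb{C}^3$ is defined by $P_{A_3}^d(e_1(t),e_2(t),e_3(t))=(e_1(t^d),e_2(t^d),e_3(t^d))$ for $t=(t_1,t_2,t_3,t_4)\in(\mathbb{C}^* )^4$ with $t_1t_2t_3t_4=1$, where $t^d=(t_1^d,\dots,t_4^d)$ and $e_j$ is the $j$-th elementary symmetric polynomial. With $M_3(x,y,z)=(x+iy,\,z,\,x-iy)$ put $f_d=M_3^{-1}\circ P_{A_3}^d\circ M_3$. $D_4\subset GL(3,\mathbb{R})$ is the dihedral group of order 8 generated by $(x,y,z)\mapsto(-y,x,-z)$ and $(x,y,z)\mapsto(x,-y,z)$. The map $\tilde F(x,y,z)=(x^2+y^2,\,z^2,\,z(x^2-y^2),\,(x^2-y^2)^2)$ from $\mathbb{C}^3$ onto $X_Q$ (coordinates $(p,q,r,s)$) induces a bijection $\mathbb{C}^3/D_4\simeq X_Q$, and $g_d:X_Q\to X_Q$ is the unique map with $g_d\circ\tilde F=\tilde F\circ f_d$ (it is a morphism). *)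

(* Defs.v *)
From HB Require Import structures.
From mathcomp Require Import all_boot all_order all_algebra.
From mathcomp Require Import ring.
From mathcomp Require Import boolp classical_sets.

Set Implicit Arguments.
Unset Strict Implicit.
Unset Printing Implicit Defensive.

Import Order.TTheory GRing.Theory Num.Theory.

Local Open Scope classical_set_scope.
Local Open Scope ring_scope.

Notation C3 K := (K * K * K)%type.
Notation C4 K := (K * K * K * K)%type.

Definition is_chebyshev (K : numClosedFieldType) (d : nat) (T : {poly K}) : Prop :=
  forall s : K, s != 0 -> T.[s + s^-1] = s ^+ d + s ^- d.

Fixpoint chebyshev_pair (K : numClosedFieldType) (d : nat) : {poly K} * {poly K} :=
  if d is d'.+1 then
    let: (a, b) := chebyshev_pair K d' in (b, 'X * b - a)
  else (2%:P, 'X).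

Lemma chebyshev_exists (K : numClosedFieldType) (d : nat) :
  exists T : {poly K}, is_chebyshev d T.
Proof.
suff H : is_chebyshev d (chebyshev_pair K d).1 /\
         is_chebyshev d.+1 (chebyshev_pair K d).2.
  by exists (chebyshev_pair K d).1; case: H.
elim: d => [|d] /=.
  split=> s s0; first by rewrite hornerC expr0 invr1.
  by rewrite hornerX expr1.
case: (chebyshev_pair K d) => a b /= [Ha Hb]; split=> // s s0.
rewrite hornerD hornerN hornerM hornerX Ha // Hb // -!exprVn.
have V : s * s^-1 = 1 by rewrite divff.
rewrite !exprS mulrDl !mulrDr !mulrA V.
by rewrite (mulrC s^-1 s) V !mul1r; ring.
Qed.

Lemma chebyshev_unique (K : numClosedFieldType) (d : nat) (T U : {poly K}) :
  is_chebyshev d T -> is_chebyshev d U -> T = U.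
Proof.
move=> HT HU; apply/eqP; rewrite -subr_eq0; apply/eqP.
apply: (@roots_geq_poly_eq0 _ _ [seq n%:R | n <- iota 0 (size (T - U))]).
- apply/allP => _ /mapP [n _ ->]; rewrite rootE hornerD hornerN.
  have [s s0 <-] : exists2 s : K, s != 0 & s + s^-1 = n%:R.
    pose q : {poly K} := 'X^2 - n%:R *: 'X + 1.
    have sq : size q = 3%N.
      rewrite /q -addrA size_polyDl size_polyXn //.
      rewrite (leq_ltn_trans (size_polyD _ _)) // gtn_max size_poly1 andbT.
      by rewrite size_polyN (leq_ltn_trans (size_scale_leq _ _)) // size_polyX.
    have /closed_rootP [s] : size q != 1%N by rewrite sq.
    rewrite rootE /q !hornerE => /eqP qs.
    have s0 : s != 0.
      by apply/eqP => z; move/eqP: qs; rewrite z expr0n /= mulr0 subr0 add0r oner_eq0.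
    exists s => //; apply: (mulfI s0); rewrite mulrDr divff //.
    by apply/eqP; rewrite -subr_eq0 -[X in _ == X]qs; apply/eqP; ring.
  by rewrite HT // HU // subrr.
- by rewrite map_inj_uniq ?iota_uniq // => m n /eqP; rewrite eqr_nat => /eqP.
- by rewrite size_map size_iota.
Qed.

Definition chebyshev (K : numClosedFieldType) (d : nat) : {poly K} :=
  sval (cid (chebyshev_exists K d)).

Lemma chebyshevP (K : numClosedFieldType) (d : nat) : is_chebyshev d (chebyshev K d).
Proof. exact: svalP (cid (chebyshev_exists K d)). Qed.

Definition prod4 (K : numClosedFieldType) (t : C4 K) : K :=
  let: (t1, t2, t3, t4) := t in t1 * t2 * t3 * t4.

Definition esym123 (K : numClosedFieldType) (t : C4 K) : C3 K :=
  let: (t1, t2, t3, t4) := t in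
  (t1 + t2 + t3 + t4,
   t1 * t2 + t1 * t3 + t1 * t4 + t2 * t3 + t2 * t4 + t3 * t4,
   t1 * t2 * t3 + t1 * t2 * t4 + t1 * t3 * t4 + t2 * t3 * t4).

Definition pow4 (K : numClosedFieldType) (d : nat) (t : C4 K) : C4 K :=
  let: (t1, t2, t3, t4) := t in (t1 ^+ d, t2 ^+ d, t3 ^+ d, t4 ^+ d).

(* [prod4 t = 1] already forces all coordinates of [t] to be nonzero. *)
Definition is_PA3 (K : numClosedFieldType) (d : nat) (P : C3 K -> C3 K) : Prop :=
  forall t : C4 K, prod4 t = 1 -> P (esym123 t) = esym123 (pow4 d t).

Definition seq4 (K : numClosedFieldType) (t : C4 K) : seq K :=
  let: (t1, t2, t3, t4) := t in [:: t1; t2; t3; t4].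

Definition quartic (K : numClosedFieldType) (e : C3 K) (m : K) : {poly K} :=
  let: (e1, e2, e3) := e in
  'X^4 - e1%:P * 'X^3 + e2%:P * 'X^2 - e3%:P * 'X + m%:P.

Lemma quarticE (K : numClosedFieldType) (t : C4 K) :
  \prod_(a <- seq4 t) ('X - a%:P) = quartic (esym123 t) (prod4 t).
Proof.
case: t => [[[a b] c] d] /=; rewrite !big_cons big_nil.
by rewrite !(polyCD, polyCM); ring.
Qed.

Lemma quarticP (K : numClosedFieldType) (e : C3 K) (m : K) :
  quartic e m = Poly [:: m; - e.2; e.1.2; - e.1.1; 1].
Proof.
case: e => [[a b] c] /=; rewrite !cons_poly_def !polyCN mul0r add0r.
ring.
Qed.

Lemma quartic_inj (K : numClosedFieldType) (e e' : C3 K) (m m' : K) :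
  quartic e m = quartic e' m' -> e = e'.
Proof.
rewrite !quarticP => E.
have H i : [:: m; - e.2; e.1.2; - e.1.1; 1]`_i =
           [:: m'; - e'.2; e'.1.2; - e'.1.1; 1]`_i by rewrite -[LHS]coef_Poly E coef_Poly.
move: (H 1%N) (H 2%N) (H 3%N) => /= /oppr_inj H1 H2 /oppr_inj H3.
by move: e e' {E H} H1 H2 H3 => [[a b] c] [[a' b'] c'] /= -> -> ->.
Qed.

Lemma esym123_surj (K : numClosedFieldType) (e : C3 K) :
  exists2 t : C4 K, prod4 t = 1 & esym123 t = e.
Proof.
have [r] := closed_field_poly_normal (quartic e 1).
have E : quartic e 1 = [:: 1; - e.2; e.1.2; - e.1.1; 1] :> seq _.
  by rewrite quarticP (@PolyK _ 0) //= oner_neq0.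
rewrite lead_coefE E /= scale1r => Q.
have : size r = 4%N.
  by apply: succn_inj; rewrite -(size_prod_XsubC r id) -Q E.
move: r Q => [|a [|b [|c [|d [|? ?]]]]] //= Q _.
have {}Q : quartic e 1 = quartic (esym123 (a, b, c, d)) (prod4 (a, b, c, d)).
  by rewrite -quarticE.
exists (a, b, c, d); last by rewrite -(quartic_inj Q).
by have := congr1 (fun p : {poly K} => p`_0) Q; rewrite !quarticP !coef_Poly.
Qed.

Lemma esym123_pow (K : numClosedFieldType) (d : nat) (t u : C4 K) :
  prod4 t = 1 -> prod4 u = 1 -> esym123 t = esym123 u ->
  esym123 (pow4 d t) = esym123 (pow4 d u).
Proof.
move=> t1 u1 E.
have tu : perm_eq (seq4 t) (seq4 u).
  by apply: prod_XsubC_eq; rewrite !quarticE t1 u1 E.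
have powE (v : C4 K) : seq4 (pow4 d v) = [seq a ^+ d | a <- seq4 v].
  by case: v => [[[? ?] ?] ?].
apply: (@quartic_inj _ _ _ (prod4 (pow4 d t)) (prod4 (pow4 d u))).
by rewrite -!quarticE !powE; apply: perm_big; apply: perm_map.
Qed.

Lemma PA3_exists (K : numClosedFieldType) (d : nat) :
  exists P : C3 K -> C3 K, is_PA3 d P.
Proof.
have H (e : C3 K) : exists t : C4 K, prod4 t = 1 /\ esym123 t = e.
  by have [t ? ?] := esym123_surj e; exists t.
exists (fun e => esym123 (pow4 d (sval (cid (H e))))) => t t1.
by case: cid => u /= [u1 uE]; apply: esym123_pow.
Qed.

Lemma PA3_unique (K : numClosedFieldType) (d : nat) (P Q : C3 K -> C3 K) :
  is_PA3 d P -> is_PA3 d Q -> P = Q.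
Proof.
move=> HP HQ; apply/funext => e.
by have [t t1 <-] := esym123_surj e; rewrite HP // HQ.
Qed.

Definition PA3 (K : numClosedFieldType) (d : nat) : C3 K -> C3 K :=
  sval (cid (PA3_exists K d)).

Lemma PA3P (K : numClosedFieldType) (d : nat) : is_PA3 d (@PA3 K d).
Proof. exact: svalP (cid (PA3_exists K d)). Qed.

Definition M3 (K : numClosedFieldType) (u : C3 K) : C3 K :=
  let: (x, y, z) := u in (x + 'i * y, z, x - 'i * y).

Definition M3inv (K : numClosedFieldType) (u : C3 K) : C3 K :=
  let: (a, b, c) := u in ((a + c) / 2, (a - c) / (2 * 'i), b).

Lemma M3K (K : numClosedFieldType) : cancel (@M3 K) (@M3inv K).
Proof.
have i0 := @neq0Ci K.
by move=> [[x y] z]; rewrite /M3inv /M3; congr (_, _, _); field.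
Qed.

Lemma M3invK (K : numClosedFieldType) : cancel (@M3inv K) (@M3 K).
Proof.
have i0 := @neq0Ci K.
by move=> [[a b] c]; rewrite /M3inv /M3; congr (_, _, _); field.
Qed.

Definition fd (K : numClosedFieldType) (d : nat) (u : C3 K) : C3 K :=
  M3inv (PA3 d (M3 u)).

Definition D4_rot (K : numClosedFieldType) (u : C3 K) : C3 K :=
  let: (x, y, z) := u in (- y, x, - z).

Definition D4_refl (K : numClosedFieldType) (u : C3 K) : C3 K :=
  let: (x, y, z) := u in (x, - y, z).

(* Both generators have finite order, so closing up under them alone (without
   their inverses) already gives the orbits of the group they generate. *)
Inductive D4_orbit (K : numClosedFieldType) (u : C3 K) : C3 K -> Prop :=
| D4_orbit_id : D4_orbit u u
| D4_orbit_rot v : D4_orbit u v -> D4_orbit u (D4_rot v)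
| D4_orbit_refl v : D4_orbit u v -> D4_orbit u (D4_refl v).

Definition XQ (K : numClosedFieldType) : set (C4 K) :=
  [set v | let: (p, q, r, s) := v in r ^+ 2 - q * s = 0].

Arguments XQ : clear implicits.

Definition tildeF_val (K : numClosedFieldType) (u : C3 K) : C4 K :=
  let: (x, y, z) := u in
  (x ^+ 2 + y ^+ 2, z ^+ 2, z * (x ^+ 2 - y ^+ 2), (x ^+ 2 - y ^+ 2) ^+ 2).

Lemma tildeF_XQ (K : numClosedFieldType) (u : C3 K) : XQ K (tildeF_val u).
Proof. by case: u => [[x y] z]; rewrite /XQ /=; ring. Qed.

Definition tildeF (K : numClosedFieldType) (u : C3 K) : XQ K :=
  SigSub (mem_set (tildeF_XQ u)).

Lemma tildeF_surj (K : numClosedFieldType) (v : XQ K) : exists u : C3 K, tildeF u = v.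
Proof.
suff [u Hu] : exists u, tildeF_val u = val v by exists u; apply: val_inj.
have := set_valP v; case: (val v) => [[[p q] r] s]; rewrite /XQ /= => /eqP.
rewrite subr_eq0 => /eqP rqs.
(* a square root [k] of [s], then [z] with [z k = r] and [z^2 = q] *)
have [k [z [ks zk zq]]] : exists k z, [/\ k ^+ 2 = s, z * k = r & z ^+ 2 = q].
  have [s0|s0] := eqVneq s 0.
    exists 0, (sqrtC q); rewrite sqrtCK s0 mulr0 expr0n; split=> //.
    by apply/esym/eqP; rewrite -sqrf_eq0 rqs s0 mulr0.
  have k0 : sqrtC s != 0 by rewrite sqrtC_eq0.
  exists (sqrtC s), (r / sqrtC s); rewrite sqrtCK divfK //; split=> //.
  by rewrite expr_div_n sqrtCK rqs mulfK.
exists (sqrtC ((p + k) / 2), sqrtC ((p - k) / 2), z) => /=.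
by rewrite !sqrtCK -ks -zk -zq; congr (_, _, _, _); field.
Qed.

Lemma tildeF_orbit (K : numClosedFieldType) (u v : C3 K) :
  tildeF u = tildeF v <-> D4_orbit u v.
Proof.
split; last first.
  elim=> [//|w _ ->|w _ ->]; apply: val_inj; case: w => [[x y] z] /=;
    by congr (_, _, _, _); ring.
move=> /(congr1 val); case: u v => [[x y] z] [[x' y'] z'] /= [E1 E2 E3 E4].
(* replace [u] by [w] in its orbit so that x^2, y^2 and z match *)
have [w [ow E]] : exists w, D4_orbit (x, y, z) w /\
    [/\ w.1.1 ^+ 2 = x' ^+ 2, w.1.2 ^+ 2 = y' ^+ 2 & w.2 = z'].
  have two0 : (2 : K) != 0 by rewrite pnatr_eq0.
  have sq (a b c e : K) : a + b = c + e -> a - b = c - e -> a = c /\ b = e.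
    move=> H1 H2; split; apply: (mulfI two0).
      have -> : 2 * a = (a + b) + (a - b) by ring.
      by rewrite H1 H2; ring.
    have -> : 2 * b = (a + b) - (a - b) by ring.
    by rewrite H1 H2; ring.
  have rot := D4_orbit_rot (D4_orbit_id (x, y, z)).
  have [D0|D0] := eqVneq (x' ^+ 2 - y' ^+ 2) 0.
    have D : x ^+ 2 - y ^+ 2 = 0.
      by apply/eqP; rewrite -sqrf_eq0 E4 D0 expr0n.
    have [ex ey] : x ^+ 2 = x' ^+ 2 /\ y ^+ 2 = y' ^+ 2.
      by apply: sq => //; rewrite D D0.
    have /eqP := E2; rewrite eqf_sqr => /orP [] /eqP ez.
      by exists (x, y, z); split; [exact: D4_orbit_id | split].
    exists (D4_rot (x, y, z)); split=> //=; split.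
    - rewrite sqrrN ey; apply/eqP; rewrite eq_sym -subr_eq0; exact/eqP.
    - by rewrite ex; apply/eqP; rewrite -subr_eq0; apply/eqP.
    - by rewrite ez opprK.
  have /eqP := E4; rewrite eqf_sqr => /orP [] /eqP D.
    have [ex ey] := sq _ _ _ _ E1 D.
    exists (x, y, z); split; [exact: D4_orbit_id | split=> //=].
    by apply: (mulIf D0); rewrite -E3 D.
  have [ey ex] : y ^+ 2 = x' ^+ 2 /\ x ^+ 2 = y' ^+ 2.
    apply: sq; first by rewrite addrC.
    by rewrite -opprB D opprK.
  exists (D4_rot (x, y, z)); split=> //=; split=> //; first by rewrite sqrrN.
  by apply: (mulIf D0); rewrite -E3 D; ring.
case: w ow E => [[a b] c] ow /= [/eqP Ea /eqP Eb <-].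
have o2 := D4_orbit_rot (D4_orbit_rot ow).
move: Ea Eb ow (D4_orbit_refl ow) o2 (D4_orbit_refl o2).
rewrite /= !opprK !eqf_sqr.
by move=> /orP [] /eqP -> /orP [] /eqP ->; rewrite ?opprK.
Qed.

Lemma PA3_rot (K : numClosedFieldType) (d : nat) (a b c : K) :
  PA3 d ('i * a, - b, - 'i * c) =
  let: (a', b', c') := PA3 d (a, b, c) in
  ('i ^+ d * a', (-1) ^+ d * b', (- 'i) ^+ d * c').
Proof.
have I2 := sqrCi K.
have [[[[t1 t2] t3] t4] t0 tE] := esym123_surj (a, b, c).
have uE : esym123 ('i * t1, 'i * t2, 'i * t3, 'i * t4) = ('i * a, - b, - 'i * c).
  by move: tE => /= [<- <- <-]; congr (_, _, _); ring: I2.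
have u0 : prod4 ('i * t1, 'i * t2, 'i * t3, 'i * t4) = 1.
  by rewrite -t0 /=; ring: I2.
rewrite -uE -tE !PA3P //= !exprMn.
have J2 : (-1) ^+ d = 'i ^+ d * 'i ^+ d :> K by rewrite -exprMn -expr2 I2.
have J3 : (- 'i) ^+ d = 'i ^+ d * 'i ^+ d * 'i ^+ d :> K.
  by rewrite -!exprMn -expr2 I2 mulN1r.
by rewrite J2 J3; congr (_, _, _); ring.
Qed.

Lemma PA3_swap (K : numClosedFieldType) (d : nat) (a b c : K) :
  PA3 d (c, b, a) = let: (a', b', c') := PA3 d (a, b, c) in (c', b', a').
Proof.
have [[[[t1 t2] t3] t4] u1 tE] := esym123_surj (a, b, c).
have /= t0 := u1.
(* the inverses of the t_j, up to the relation t1 t2 t3 t4 = 1 *)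
have uE : esym123 (t2 * t3 * t4, t1 * t3 * t4, t1 * t2 * t4, t1 * t2 * t3) = (c, b, a).
  by move: tE => /= [<- <- <-]; congr (_, _, _); ring: t0.
have u0 : prod4 (t2 * t3 * t4, t1 * t3 * t4, t1 * t2 * t4, t1 * t2 * t3) = 1.
  by rewrite /=; ring: t0.
rewrite -uE -tE !PA3P //= !exprMn.
have T0 : t1 ^+ d * t2 ^+ d * t3 ^+ d * t4 ^+ d = 1.
  by rewrite -!exprMn t0 expr1n.
by congr (_, _, _); ring: T0.
Qed.

Lemma D4_orbit_trans (K : numClosedFieldType) (u v w : C3 K) :
  D4_orbit u v -> D4_orbit v w -> D4_orbit u w.
Proof.
by move=> uv; elim=> // x _; [apply: D4_orbit_rot | apply: D4_orbit_refl].
Qed.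

Lemma fd_rot (K : numClosedFieldType) (d : nat) (u : C3 K) :
  fd d (D4_rot u) = iter d (@D4_rot K) (fd d u).
Proof.
have I2 := sqrCi K.
have M3rot (v : C3 K) : M3 (D4_rot v) =
    let: (a, b, c) := M3 v in ('i * a, - b, - 'i * c).
  by case: v => [[x y] z] /=; congr (_, _, _); ring: I2.
apply: (can_inj (@M3K K)); rewrite /fd M3invK M3rot.
have M3iter n (v : C3 K) : M3 (iter n (@D4_rot K) v) =
    let: (a, b, c) := M3 v in ('i ^+ n * a, (-1) ^+ n * b, (- 'i) ^+ n * c).
  elim: n => [|n IH]; first by case: v => [[x y] z] /=; rewrite !mul1r.
  rewrite iterS M3rot IH; case: (M3 v) => [[a b] c].
  by rewrite !exprS; congr (_, _, _); ring.
by rewrite M3iter M3invK; case: (M3 u) => [[a b] c]; rewrite PA3_rot.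
Qed.

Lemma fd_refl (K : numClosedFieldType) (d : nat) (u : C3 K) :
  fd d (D4_refl u) = D4_refl (fd d u).
Proof.
have M3refl (v : C3 K) : M3 (D4_refl v) = let: (a, b, c) := M3 v in (c, b, a).
  by case: v => [[x y] z] /=; congr (_, _, _); ring.
apply: (can_inj (@M3K K)); rewrite /fd M3invK !M3refl M3invK.
by case: (M3 u) => [[a b] c]; rewrite PA3_swap.
Qed.

Lemma fd_orbit (K : numClosedFieldType) (d : nat) (u v : C3 K) :
  D4_orbit u v -> D4_orbit (fd d u) (fd d v).
Proof.
elim=> [|w _ IH|w _ IH]; first exact: D4_orbit_id.
- rewrite fd_rot; elim: {2}d => // n; exact: D4_orbit_rot.
- by rewrite fd_refl; apply: D4_orbit_refl.
Qed.

Definition is_induced (K : numClosedFieldType) (d : nat) (g : XQ K -> XQ K) : Prop :=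
  forall u : C3 K, g (tildeF u) = tildeF (fd d u).

Lemma induced_exists (K : numClosedFieldType) (d : nat) :
  exists g : XQ K -> XQ K, is_induced d g.
Proof.
exists (fun v => tildeF (fd d (sval (cid (tildeF_surj v))))) => u.
case: cid => w /= /tildeF_orbit wu.
by apply/tildeF_orbit/fd_orbit.
Qed.

Lemma induced_unique (K : numClosedFieldType) (d : nat) (g h : XQ K -> XQ K) :
  is_induced d g -> is_induced d h -> g = h.
Proof.
move=> Hg Hh; apply/funext => v.
by have [u <-] := tildeF_surj v; rewrite Hg Hh.
Qed.

Definition gd (K : numClosedFieldType) (d : nat) : XQ K -> XQ K :=
  sval (cid (induced_exists K d)).

Lemma gdP (K : numClosedFieldType) (d : nat) : is_induced d (@gd K d).
Proof. exact: svalP (cid (induced_exists K d)). Qed.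

(* Image in C^4 of a subset [A] of X_Q, itself given as a subset of C^4. *)
Definition gd_image (K : numClosedFieldType) (d : nat) (A : set (C4 K)) : set (C4 K) :=
  [set val (gd d v) | v in [set v : XQ K | A (val v)]].

Definition L1 (K : numClosedFieldType) : set (C4 K) :=
  [set v | let: (p, q, r, s) := v in [/\ q = 0, r = 0 & s = 0]].

Arguments L1 : clear implicits.

Lemma L1E (K : numClosedFieldType) : L1 K = [set (t, 0, 0, 0) | t in [set: K]].
Proof.
apply/seteqP; split=> [[[[p q] r] s] /= [-> -> ->]|_ [t _ <-] //].
by exists p.
Qed.

Lemma L1_sub_XQ (K : numClosedFieldType) : L1 K `<=` XQ K.
Proof.
by move=> [[[p q] r] s] /= [-> -> ->]; rewrite /XQ /= mulr0 expr0n subr0.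
Qed.

Lemma L1_pt_XQ (K : numClosedFieldType) (t : K) : XQ K ((t, 0, 0, 0) : C4 K).
Proof. exact: L1_sub_XQ. Qed.

Definition L1_pt (K : numClosedFieldType) (t : K) : XQ K :=
  SigSub (mem_set (L1_pt_XQ t)).

Definition G1_val (K : numClosedFieldType) (t : K) : C4 K :=
  (t ^+ 2, (2 * t - 2) ^+ 2, (2 * t - 2) * t ^+ 2, t ^+ 4).

Lemma G1_XQ (K : numClosedFieldType) (t : K) : XQ K (G1_val t).
Proof. by rewrite /XQ /G1_val /=; ring. Qed.

Definition G1 (K : numClosedFieldType) (t : K) : XQ K := SigSub (mem_set (G1_XQ t)).

Definition C1 (K : numClosedFieldType) : set (C4 K) :=
  [set v | let: (p, q, r, s) := v in
    [/\ r ^+ 2 - q * s = 0,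
        - 16 * p - 12 * r + q * r + 20 * s - 4 * p * s + q * s = 0 &
        [/\ 4 * p * r + 4 * s - 4 * p * s + q * s = 0,
            16 - 8 * q + q ^+ 2 + 32 * r - 16 * s = 0,
            4 * p + p * q + 4 * r - 4 * s = 0 &
            p ^+ 2 - s = 0]]].

Arguments C1 : clear implicits.

Lemma C1_sub_XQ (K : numClosedFieldType) : C1 K `<=` XQ K.
Proof. by move=> [[[p q] r] s] []. Qed.

(* Main.v *)
(* Computing on the torus cover t |-> tildeF (M3^-1 (e(t))), on which g_d acts by
   t |-> t^d: with zeta^2 = i, the point of L1 with parameter (v + 1/v)^2 is the
   image of zeta(1, -1, v, 1/v), and the point of C1 with parameter v + 1/v + 2
   is the image of eta(1, 1, v, 1/v) for any fourth root of unity eta.  Odd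
   powers preserve the first family, squaring sends it to the second, and every
   power preserves the second. *)
Require Import Defs.
From HB Require Import structures.
From mathcomp Require Import all_boot all_order all_algebra.
From mathcomp Require Import ring.
From mathcomp Require Import complex.
From mathcomp Require Import boolp classical_sets reals.

Set Implicit Arguments.
Unset Strict Implicit.
Unset Printing Implicit Defensive.

Import Order.TTheory GRing.Theory Num.Theory.

Local Open Scope classical_set_scope.
Local Open Scope ring_scope.

Section TorusCover.

Variable K : numClosedFieldType.
Implicit Types (t : C4 K) (v w z p q r s : K) (d : nat).

Definition torus_cover t : XQ K := tildeF (M3inv (esym123 t)).

Lemma gd_torus_cover d t :
  prod4 t = 1 -> gd d (torus_cover t) = torus_cover (pow4 d t).
Proof. by move=> t1; rewrite /torus_cover gdP /fd M3invK PA3P. Qed.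

(** With [a = x + 'i y] and [c = x - 'i y], one has [a c = x^2 + y^2] and
    [a^2 + c^2 = 2 (x^2 - y^2)]. *)
Lemma val_tildeF_M3inv (a b c : K) :
  val (tildeF (M3inv (a, b, c))) =
  (a * c, b ^+ 2, b * (a ^+ 2 + c ^+ 2) / 2, (a ^+ 2 + c ^+ 2) ^+ 2 / 4).
Proof.
have I2 := sqrCi K; have i0 := @neq0Ci K.
have E : ((a - c) / (2 * 'i)) ^+ 2 = - ((a - c) / 2) ^+ 2.
  by rewrite invfM mulrA exprMn exprVn I2 invrN invr1 mulrN1.
by rewrite /= E; congr (_, _, _, _); field.
Qed.

Lemma sum_inv_surj s : exists2 v : K, v != 0 & v + v^-1 = s.
Proof.
(* [v] and its inverse are the two roots of [X^2 - s X + 1], whose discriminant is [e^2]. *)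
pose e := sqrtC (s ^+ 2 - 4); have e2 : e ^+ 2 = s ^+ 2 - 4 by rewrite sqrtCK.
have V : (s + e) / 2 * ((s - e) / 2) = 1.
  have -> : (s + e) / 2 * ((s - e) / 2) = (s ^+ 2 - e ^+ 2) / 4 by field.
  by rewrite e2; field.
have v0 : (s + e) / 2 != 0.
  by apply: contra_eq_neq V => ->; rewrite mul0r eq_sym oner_neq0.
exists ((s + e) / 2) => //.
have -> : ((s + e) / 2)^-1 = (s - e) / 2 by apply: (mulfI v0); rewrite V divff.
by field.
Qed.

Lemma chebyshev_surj d w : (0 < d)%N -> exists s : K, (chebyshev K d).[s] = w.
Proof.
move=> d0; have [v v0 <-] := sum_inv_surj w.
(* As [w = v + v^-1], a [d]-th root [b] of [v] gives [T_d(b + b^-1) = w]. *)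
have rd := rootCK d0 v; exists (d.-root v + (d.-root v)^-1).
by rewrite chebyshevP ?rootC_eq0 // rd.
Qed.

Definition L1_lift z v : C4 K := (z, - z, z * v, z * v^-1).

Definition C1_lift z v : C4 K := (z, z, z * v, z * v^-1).

Lemma prod4_L1_lift z v : z ^+ 4 = -1 -> v != 0 -> prod4 (L1_lift z v) = 1.
Proof.
move=> z4 v0; have -> : prod4 (L1_lift z v) = - z ^+ 4 by rewrite /=; field.
by rewrite z4 opprK.
Qed.

Lemma prod4_C1_lift z v : z ^+ 4 = 1 -> v != 0 -> prod4 (C1_lift z v) = 1.
Proof. by move=> z4 v0; rewrite -z4 /=; field. Qed.

(** The lift has [e1 = z (v + v^-1)], [e2 = 0] and [e3 = - z^3 (v + v^-1)]; since [z^4 = -1],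
    [e1^2 + e3^2] vanishes and [e1 e3 = (v + v^-1)^2]. *)
Lemma torus_cover_L1_lift z v : z ^+ 4 = -1 -> v != 0 ->
  torus_cover (L1_lift z v) = L1_pt ((v + v^-1) ^+ 2).
Proof.
move=> z4 v0; apply: val_inj; rewrite val_tildeF_M3inv /=.
(* The inverse becomes a variable [u] with [v * u = 1], a relation that [ring] can use. *)
have V := divff v0; move: (v^-1) V => u V.
have -> : z + - z + z * v + z * u = z * (v + u) by ring.
have -> : z * - z + z * (z * v) + z * (z * u) + - z * (z * v) + - z * (z * u) +
    z * v * (z * u) = 0 by ring: V.
have -> : z * - z * (z * v) + z * - z * (z * u) + z * (z * v) * (z * u) +
    - z * (z * v) * (z * u) = - z ^+ 3 * (v + u) by ring.
have -> : (z * (v + u)) ^+ 2 + (- z ^+ 3 * (v + u)) ^+ 2 = 0 by ring: z4.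
by rewrite mul0r !expr0n /= !mul0r; congr (_, _, _, _); ring: z4.
Qed.

(** With [y = v + v^-1 + 2], the lift has [e1 = z y], [e2 = z^2 (2 y - 2)] and [e3 = z^3 y], so the
    coordinates are those of [G1 y] up to factors [z^4 = 1]. *)
Lemma torus_cover_C1_lift z v : z ^+ 4 = 1 -> v != 0 ->
  torus_cover (C1_lift z v) = G1 (v + v^-1 + 2).
Proof.
move=> z4 v0; apply: val_inj; rewrite val_tildeF_M3inv /= /G1_val.
have V := divff v0; move: (v^-1) V => u V.
have -> : z + z + z * v + z * u = z * (v + u + 2) by ring.
have -> : z * z + z * (z * v) + z * (z * u) + z * (z * v) + z * (z * u) +
    z * v * (z * u) = z ^+ 2 * (2 * (v + u + 2) - 2) by ring: V.
have -> : z * z * (z * v) + z * z * (z * u) + z * (z * v) * (z * u) +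
    z * (z * v) * (z * u) = z ^+ 3 * (v + u + 2) by ring: V.
have -> : (z * (v + u + 2)) ^+ 2 + (z ^+ 3 * (v + u + 2)) ^+ 2 =
  2 * z ^+ 2 * (v + u + 2) ^+ 2 by ring: z4.
set y := v + u + 2.
have -> : z ^+ 2 * (2 * y - 2) * (2 * z ^+ 2 * y ^+ 2) / 2 =
  z ^+ 4 * ((2 * y - 2) * y ^+ 2) by field.
have -> : (2 * z ^+ 2 * y ^+ 2) ^+ 2 / 4 = z ^+ 4 * y ^+ 4 by field.
by congr (_, _, _, _); ring: z4.
Qed.

Lemma pow4_L1_lift_odd d z v :
  odd d -> pow4 d (L1_lift z v) = L1_lift (z ^+ d) (v ^+ d).
Proof.
by move=> od; rewrite /L1_lift /= !exprMn exprVn exprNn -signr_odd od mulN1r.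
Qed.

Lemma pow4_L1_lift2 z v : pow4 2 (L1_lift z v) = C1_lift (z ^+ 2) (v ^+ 2).
Proof. by rewrite /L1_lift /C1_lift /= !exprMn exprVn sqrrN. Qed.

Lemma pow4_C1_lift d z v : pow4 d (C1_lift z v) = C1_lift (z ^+ d) (v ^+ d).
Proof. by rewrite /C1_lift /= !exprMn exprVn. Qed.

Lemma gd_L1_pt_odd d s : odd d ->
  gd d (L1_pt (s ^+ 2)) = L1_pt ((chebyshev K d).[s] ^+ 2).
Proof.
move=> od; have [v v0 <-] := sum_inv_surj s.
(* The choice of [z] is an eighth root of unity; since [d] is odd, [z^d] is again a fourth root of
   [-1]. *)
have z4 : sqrtC 'i ^+ 4 = -1 :> K by rewrite (exprM _ 2 2) sqrtCK sqrCi.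
have zd4 : (sqrtC 'i ^+ d) ^+ 4 = -1 :> K.
  by rewrite exprAC z4 -signr_odd od.
rewrite chebyshevP // -(torus_cover_L1_lift z4 v0).
rewrite gd_torus_cover ?prod4_L1_lift // pow4_L1_lift_odd //.
by rewrite torus_cover_L1_lift // expf_neq0.
Qed.

Lemma gd2_L1_pt s : gd 2 (L1_pt (s ^+ 2)) = G1 ((chebyshev K 2).[s] + 2).
Proof.
have [v v0 <-] := sum_inv_surj s.
have z4 : sqrtC 'i ^+ 4 = -1 :> K by rewrite (exprM _ 2 2) sqrtCK sqrCi.
rewrite chebyshevP // -(torus_cover_L1_lift z4 v0).
rewrite gd_torus_cover ?prod4_L1_lift // pow4_L1_lift2 torus_cover_C1_lift //.
  by rewrite exprAC z4 sqrrN expr1n.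
by rewrite expf_neq0.
Qed.

Lemma gd_G1 d w : gd d (G1 (w + 2)) = G1 ((chebyshev K d).[w] + 2).
Proof.
have [v v0 <-] := sum_inv_surj w.
have z4 : 1 ^+ 4 = 1 :> K by rewrite expr1n.
rewrite chebyshevP // -(torus_cover_C1_lift z4 v0).
rewrite gd_torus_cover ?prod4_C1_lift // pow4_C1_lift expr1n.
by rewrite torus_cover_C1_lift // expf_neq0.
Qed.

Lemma L1_sqr (x : XQ K) : L1 K (val x) -> exists s : K, x = L1_pt (s ^+ 2).
Proof.
rewrite L1E => -[t _ tx]; exists (sqrtC t).
by apply: val_inj; rewrite -tx /= sqrtCK.
Qed.

Lemma C1_G1_val w : C1 K (G1_val w).
Proof. by rewrite /C1 /G1_val /=; split; [ring | ring | split; ring]. Qed.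

(** Two of the equations express [s] and [r] through [p] and [q]; it remains to find [t] with
    [p = t^2] and [q = (2t - 2)^2]. *)
Lemma C1_G1 (x : XQ K) : C1 K (val x) -> exists w : K, x = G1 (w + 2).
Proof.
move=> Cx; suff [t tx] : exists t : K, val x = G1_val t.
  by exists (t - 2); apply: val_inj; rewrite tx /= subrK.
case: (val x) Cx => [[[p q] r] s] [_ _ [_ E1 E2 E3]].
have Es : s = p ^+ 2 by apply/esym/eqP; rewrite -subr_eq0 E3.
have Er : r = (4 * s - 4 * p - p * q) / 4.
  have -> : r = ((4 * p + p * q + 4 * r - 4 * s) + 4 * s - 4 * p - p * q) / 4.
    by field.
  by rewrite E2 add0r.
(* on the curve q = (2t - 2)^2 with p = t^2, which is linear in t *)
pose t := (4 * p + 4 - q) / 8; have Ep : p = t ^+ 2.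
  (* [64 (t^2 - p)] is a linear combination of three defining equations of [C1]. *)
  have -> : t ^+ 2 = p + ((16 - 8 * q + q ^+ 2 + 32 * r - 16 * s)
      - 8 * (4 * p + p * q + 4 * r - 4 * s) + 16 * (p ^+ 2 - s)) / 64.
    by rewrite /t; field.
  by rewrite E1 E2 E3 !mulr0 subr0 addr0 mul0r addr0.
have Eq : q = 4 * p + 4 - 8 * t by rewrite /t; field.
exists t; rewrite /G1_val Er Es Eq Ep; congr (_, _, _, _); try ring; by field.
Qed.

End TorusCover.

Theorem proposition4p15 (R : realType) :
  [/\ forall d : nat, odd d ->
        gd_image d (L1 R[i]) = L1 R[i] /\
        (forall t s : R[i], s ^+ 2 = t ->
           gd d (L1_pt t) = L1_pt ((chebyshev R[i] d).[s] ^+ 2)),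
      gd_image 2 (L1 R[i]) = C1 R[i] &
      forall d : nat, (1 <= d)%N ->
        gd_image d (C1 R[i]) = C1 R[i] /\
        (forall w : R[i],
           gd d (G1 (w + 2)) = G1 ((chebyshev R[i] d).[w] + 2))].
Proof.
split=> [d od||d d0].
- split=> [|t s <-]; last exact: gd_L1_pt_odd.
  have d0 : (0 < d)%N by case: d od.
  apply/seteqP; split=> [_ [x /L1_sqr[s ->] <-]|]; first by rewrite gd_L1_pt_odd.
  (* Surjectivity: [T_d(s) = sqrtC t] makes [T_d(s)^2 = t]. *)
  rewrite {1}L1E => _ [t _ <-]; have [s sE] := chebyshev_surj (sqrtC t) d0.
  by exists (L1_pt (s ^+ 2)); [split | rewrite gd_L1_pt_odd // sE /= sqrtCK].
- apply/seteqP; split=> [_ [x /L1_sqr[s ->] <-]|y Cy].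
    by rewrite gd2_L1_pt; exact: C1_G1_val.
  have [w wE] := @C1_G1 _ (SigSub (mem_set (C1_sub_XQ Cy))) Cy.
  (* Writing [w = T_2(s)] exhibits [y] as the image of the point of [L1] with parameter [s^2]. *)
  have [s sE] := @chebyshev_surj R[i] 2 w isT.
  by exists (L1_pt (s ^+ 2)); [split | rewrite gd2_L1_pt sE -wE].
- split=> [|w]; last exact: gd_G1.
  apply/seteqP; split=> [_ [x /C1_G1[w ->] <-]|y Cy].
    by rewrite gd_G1; exact: C1_G1_val.
  have [w wE] := @C1_G1 _ (SigSub (mem_set (C1_sub_XQ Cy))) Cy.
  have [s sE] := chebyshev_surj w d0.
  by exists (G1 (s + 2)); [exact: C1_G1_val | rewrite gd_G1 sE -wE].
Qed.
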